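(* Fix $\varepsilon>0$. Then there is a constant $C_\varepsilon$ (depending only on $\varepsilon$) such that for all positive integers $N$ there are at most $C_\varepsilon$ primes $p\le N$ with $n_p>N^{\varepsilon}$.
   Context: For an odd prime $p$, $n_p$ denotes the least positive quadratic non-residue modulo $p$, i.e. the least positive integer $x$ whose Legendre symbol satisfies $\left(\frac{x}{p}\right)=-1$. The prime $p=2$ has no quadratic non-residue, so $n_2$ is undefined and $p=2$ is not counted. *)

(* Defs.v *)
From mathcomp Require Import all_boot all_order all_algebra.
From mathcomp Require Import zify.

Set Implicit Arguments.
Unset Strict Implicit.
Unset Printing Implicit Defensive.

Import Order.TTheory GRing.Theory Num.Theory.

Local Open Scope ring_scope.

(* The Legendre symbol (x / p); meaningful for p an odd prime. *)
Definition legendre (x p : nat) : int :=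
  if (p %| x)%N then 0
  else if [exists y : 'I_p, y ^ 2 == x %[mod p]]%N then 1 else -1.

(* n_p. It suffices to search below p, since the symbol only depends on x
   modulo p; the value 0 is never selected because (0 / p) = 0. When there is
   no non-residue (p = 2) the junk value p is returned. The characterisation
   of n_p for odd primes is least_nonresidueP below. *)
Definition least_nonresidue (p : nat) : nat :=
  find (fun x => legendre x p == -1) (iota 0 p).

Lemma legendre_nonresidue_exists (p : nat) : prime p -> odd p ->
  exists2 x : nat, (x < p)%N & legendre x p = -1.
Proof.
move=> pp op; have p0 := prime_gt0 pp.
have p2 : (2 < p)%N by rewrite odd_prime_gt2.
pose f (y : 'I_p) : 'I_p := Ordinal (ltn_pmod (y ^ 2) p0).
have [/forallP sf|] := boolP [forall x : 'I_p, legendre x p != -1]; last first.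
  by rewrite negb_forall => /existsP[x]; rewrite negbK => /eqP ex; exists x.
have f_onto (x : 'I_p) : x \in codom f.
  have := sf x; rewrite /legendre.
  case: ifP => [/dvdnP[k xk] _|_].
    apply/codomP; exists x; apply: val_inj => /=.
    by rewrite xk -mulnn mulnA modnMl; have := ltn_ord x;
       rewrite xk; case: k {xk} => // k; rewrite mulSn ltnNge leq_addr.
  case: ifP => // /existsP[y /eqP yx] _.
  by apply/codomP; exists y; apply: val_inj; rewrite /= yx modn_small.
have f_inj : injective f.
  apply/injectiveP/card_uniqP; rewrite size_codom.
  by apply: eq_card => x; rewrite f_onto.
have p1 : (1 < p)%N by exact: prime_gt1.
have pm : (p.-1 < p)%N by rewrite prednK.
have /(congr1 val)/= : Ordinal p1 = Ordinal pm.
  apply: f_inj; apply: val_inj => /=.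
  have -> : (p.-1 ^ 2 = p.-2 * p + 1)%N.
    by move: p2; clear; case: p => [|[|q]] //= _; nia.
  by rewrite modnMDl exp1n.
by move: p2; case: (p) => [|[|[|q]]].
Qed.

Lemma least_nonresidueP (p : nat) : prime p -> odd p ->
  [/\ (0 < least_nonresidue p)%N, legendre (least_nonresidue p) p = -1
    & forall x : nat, (0 < x)%N -> legendre x p = -1 ->
        (least_nonresidue p <= x)%N].
Proof.
move=> pp op; rewrite /least_nonresidue.
set a := fun x : nat => _; set n := find _ _.
have ha : has a (iota 0 p).
  have [x xp lx] := legendre_nonresidue_exists pp op.
  by apply/hasP; exists x; rewrite ?mem_iota // /a lx.
have np : (n < p)%N by rewrite -[p](size_iota 0) -has_find.
have ln : legendre n p = -1.
  by apply/eqP; have := nth_find 0%N ha; rewrite nth_iota.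
split=> // [|x _ lx].
  by rewrite lt0n; apply/eqP => n0; move: ln; rewrite n0 /legendre dvdn0.
rewrite leqNgt; apply/negP => xn.
have := before_find 0%N xn; rewrite nth_iota ?(ltn_trans xn) // add0n.
by rewrite /a lx eqxx.
Qed.

(* Main.v *)
(* Let S be the set of bad primes and Z n = sum_(p in S) (n / p). Expanding the
   square, sum_(n <= M) (Z n)^2 is at most #|S| (M + 1) + #|S|^2 N^2: for p <> q
   the product (n / p) (n / q) has period p q <= N^2 and sums to 0 over a period.
   If n is N^eps-smooth then all its prime factors are residues modulo each p
   in S, so Z n = #|S|. Hence it suffices that the N^eps-smooth integers up to M
   number at least c M, with c > 0 depending only on eps, for some M of order at
   least N^3.
   Take w = floor (N^(eps / 6)), y = w^6 and write psi X for the number of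
   y-smooth integers in [1, X]. An integer n <= w^E has at most E prime factors > w, whence
     sum_(w < p <= y) psi (X / p) <= E psi X      for X <= w^E.
   Since sum_(w < p <= y) 1 / p >= 1 / 12, the bound psi X >= c X propagates from
   X <= y (where psi X = X) to X <= y w^J by induction on J. The lower bound on
   the sum of 1 / p follows from Stirling's lower bound and the crude estimates
   n / (2 p) <= v_p (n!) <= 2 n / p for p <= n; the loss of constants in them is
   why the window is (w, w^6] rather than (w, w^2]. *)
Require Import Defs.
From mathcomp Require Import all_boot all_order all_algebra.
From mathcomp Require Import all_classical all_reals all_analysis.
From mathcomp Require Import zify lra.

Set Implicit Arguments.
Unset Strict Implicit.
Unset Printing Implicit Defensive.

Import Order.TTheory GRing.Theory Num.Theory.

Local Open Scope ring_scope.

(** * Quadratic residues *)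

Lemma legendre_mod (x p : nat) : legendre (x %% p) p = legendre x p.
Proof. by rewrite /legendre /dvdn modn_mod. Qed.

Lemma normr_legendre_le1 (x p : nat) : `|legendre x p| <= 1.
Proof. by rewrite /legendre; case: ifP => // _; case: ifP. Qed.

Lemma legendre_eq1P (x p : nat) : (0 < p)%N ->
  reflect (~~ (p %| x)%N /\ exists y : nat, y ^ 2 = x %[mod p])
          (legendre x p == 1).
Proof.
move=> p0; rewrite /legendre; case: ifP => [_|_]; first by constructor; case.
case: ifP => [/existsP ex|/negbT nex]; constructor.
  by split=> //; case: ex => y /eqP; exists y.
move=> [_ [y yx]]; case/negP: nex; apply/existsP.
by exists (Ordinal (ltn_pmod y p0)); rewrite /= modnXm yx.
Qed.

Lemma legendre1 (p : nat) : (1 < p)%N -> legendre 1 p = 1.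
Proof.
move=> p1; apply/eqP/legendre_eq1P; first exact: ltnW.
by split; [rewrite dvdn1; case: p p1 => [|[]] | exists 1%N].
Qed.

Lemma legendreM_eq1 (p x y : nat) : prime p ->
  legendre x p = 1 -> legendre y p = 1 -> legendre (x * y) p = 1.
Proof.
move=> pp; have p0 := prime_gt0 pp.
move=> /eqP/(legendre_eq1P _ p0)[px [u ux]] /eqP/(legendre_eq1P _ p0)[py [v vy]].
apply/eqP/(legendre_eq1P _ p0); rewrite Euclid_dvdM // negb_or px py; split=> //.
by exists (u * v)%N; rewrite expnMn -modnMm ux vy modnMm.
Qed.

(** [p] divides [(x - y)(x + y)]; when [y <= x] these factors lie in [[0, p)] and [[0, 2p)]. *)
Lemma eqn_sqr_mod_prime (p x y : nat) : prime p -> (x < p)%N -> (y < p)%N ->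
  x ^ 2 = y ^ 2 %[mod p] -> x = y \/ (x + y = p)%N.
Proof.
move=> pp; wlog lexy : x y / (y <= x)%N.
  move=> th xp yp e; have [/th|/ltnW/th] := leqP y x; first exact.
  by case=> // [->|]; [left | rewrite addnC; right].
move=> xp yp /eqP; rewrite eqn_mod_dvd ?leq_sqr // subn_sqr Euclid_dvdM //.
case/orP=> [d|/dvdnP[k]].
  left; apply/eqP; rewrite eqn_leq lexy andbT -subn_eq0.
  by have [//|/(dvdn_leq)/(_ d)] := posnP (x - y); lia.
by case: k => [|[|k]] e; [left; lia | right; lia | exfalso; nia].
Qed.

(** A nonzero root [y] has exactly one companion, [p - y], distinct from it as [p] is odd; the class
    of zero has only the root zero. *)
Lemma card_sqr_mod_legendre (p x : nat) : prime p -> odd p ->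
  #|[pred y : 'I_p | y ^ 2 == x %[mod p]]|%:Z = 1 + legendre x p.
Proof.
move=> pp op; have p0 := prime_gt0 pp; rewrite /legendre.
case: ifP => [px|npx].
  rewrite addr0; congr Posz; rewrite -(card1 (Ordinal p0)); apply: eq_card => y.
  rewrite !inE (eqP px) -/(dvdn p _) Euclid_dvdX // andbT -val_eqE /=.
  apply/idP/eqP => [|->]; last exact: dvdn0.
  by case: (posnP y) => // y0 /(dvdn_leq y0); rewrite leqNgt ltn_ord.
case: ifP => [/existsP[y /eqP yx]|/negbT]; last first.
  by rewrite negb_exists subrr => /forallP nx; rewrite eq_card0 // => y;
     rewrite !inE (negPf (nx y)).
have y0 : (0 < y)%N.
  rewrite lt0n; apply/eqP => y0; move: npx; rewrite /dvdn -yx y0.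
  by rewrite exp0n // mod0n eqxx.
have yp := ltn_ord y.
have py : (p - y < p)%N by lia.
rewrite (_ : 1 + 1 = 2%:Z) //; congr Posz.
have ney : y != Ordinal py.
  apply/eqP => /(congr1 val)/= e; have := op.
  by rewrite -(subnKC (ltnW yp)) -e addnn odd_double.
transitivity #|[set y; Ordinal py]|; last by rewrite cards2 ney.
apply: eq_card => z; rewrite !inE -yx; apply/eqP/idP.
  move/(eqn_sqr_mod_prime pp (ltn_ord z) yp) => [/val_inj ->|e].
    by rewrite eqxx.
  by apply/orP; right; rewrite -val_eqE /=; apply/eqP; lia.
case/orP=> /eqP -> //=.
apply/eqP; have [le|/ltnW le] := leqP y (p - y).
  by rewrite eqn_mod_dvd ?leq_sqr // subn_sqr subnK ?dvdn_mull // ltnW.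
by rewrite eq_sym eqn_mod_dvd ?leq_sqr // subn_sqr subnKC ?dvdn_mull // ltnW.
Qed.

(** Double counting: each [y] is a square root of exactly one [x], so the root counts
    [1 + legendre x p] add up to [p]. *)
Lemma sum_legendre (p : nat) : prime p -> odd p ->
  \sum_(x < p) legendre x p = 0.
Proof.
move=> pp op; have p0 := prime_gt0 pp.
have : \sum_(x < p) (1 + legendre x p) = p%:Z.
  under eq_bigr do rewrite -card_sqr_mod_legendre //.
  rewrite -(big_morph Posz PoszD (erefl _)); congr Posz.
  under eq_bigr do rewrite -sum1_card big_mkcond /=.
  rewrite exchange_big /= -[RHS]card_ord -sum1_card; apply: eq_bigr => y _.
  rewrite (bigD1 (Ordinal (ltn_pmod (y ^ 2) p0))) //= inE modn_mod eqxx.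
  rewrite big1 // => x; rewrite inE -val_eqE /= eq_sym => /negPf nx.
  by rewrite (modn_small (ltn_ord x)) nx.
rewrite big_split /= sumr_const card_ord => /(canRL (addKr _)) ->.
by rewrite natz addNr.
Qed.

(** By the Chinese remainder theorem the sum factors over pairs of residues, and the factor for [p]
    vanishes. *)
Lemma sum_legendreM (p q : nat) : prime p -> odd p -> prime q -> p != q ->
  \sum_(n < p * q) legendre n p * legendre n q = 0.
Proof.
move=> pp op pq npq; have p0 := prime_gt0 pp; have q0 := prime_gt0 pq.
have cpq : coprime p q by rewrite prime_coprime // dvdn_prime2.
pose h (n : 'I_(p * q)) := (Ordinal (ltn_pmod n p0), Ordinal (ltn_pmod n q0)).
have h_bij : bijective h.
  apply: inj_card_bij; last by rewrite card_prod !card_ord.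
  move=> m n [] /eqP emp /eqP emq; apply: val_inj => /=.
  rewrite -(modn_small (ltn_ord m)) -(modn_small (ltn_ord n)).
  by apply/eqP; rewrite chinese_remainder // emp.
transitivity (\sum_(x < p) \sum_(y < q) legendre x p * legendre y q).
  rewrite pair_big (reindex h) /=; last exact: onW_bij.
  by apply: eq_bigr => n _; rewrite !legendre_mod.
by under eq_bigr do rewrite -mulr_sumr; rewrite -mulr_suml sum_legendre ?mul0r.
Qed.

(** Full periods cancel, which leaves at most [d] terms of size at most 1. *)
Lemma normr_sum_periodic (f : nat -> int) (d M : nat) : (0 < d)%N ->
  (forall n, f (d + n)%N = f n) -> (forall n, `|f n| <= 1) ->
  \sum_(0 <= n < d) f n = 0 -> `|\sum_(0 <= n < M) f n| <= d%:Z.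
Proof.
move=> d0 fd f1 sf; elim/ltn_ind: M => M IH.
have [leMd|ltdM] := leqP M d.
  apply: le_trans (ler_norm_sum _ _ _) _.
  apply: le_trans (ler_sum _ (fun n _ => f1 n)) _.
  by rewrite sumr_const_nat subn0; lia.
rewrite (big_cat_nat (n := d)) //= ?sf ?add0r; last exact: ltnW.
rewrite -{1}[d]add0n big_addn; under eq_bigr do rewrite addnC fd.
by apply: IH; lia.
Qed.

Lemma sum_legendreM_le (p q M : nat) : prime p -> odd p -> prime q -> p != q ->
  \sum_(0 <= n < M) legendre n p * legendre n q <= (p * q)%:Z.
Proof.
move=> pp op pq npq; apply: le_trans (ler_norm _) _.
apply: normr_sum_periodic => [|n|n|]; first by rewrite muln_gt0 !prime_gt0.
- by rewrite -legendre_mod mulnC modnMDl legendre_mod mulnC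
             -(legendre_mod (_ + n)%N) modnMDl legendre_mod.
- by rewrite normrM mulr_ile1 ?normr_legendre_le1.
- by rewrite big_mkord sum_legendreM.
Qed.

(** * Smooth numbers *)

(** Since [primes 0] is empty, [0 < n] is what keeps 0 out. *)
Definition smooth (y n : nat) : bool := (0 < n)%N && all (leq^~ y) (primes n).

Definition psi (X y : nat) : nat := \sum_(0 <= n < X.+1) smooth y n.

(** A prime factor [q <= y] of [n] lies below [n_p <= p], so it is neither a multiple of [p] nor a
    non-residue; multiplicativity does the rest. *)
Lemma smooth_legendre (p y n : nat) : prime p -> odd p ->
  (y < least_nonresidue p)%N -> smooth y n -> legendre n p = 1.
Proof.
move=> pp op yp /andP[n0 /allP sn].
rewrite (prod_prime_decomp n0) prime_decompE big_map big_seq /=.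
have l1 := legendre1 (prime_gt1 pp).
elim/big_ind: _ => // [a b|q qn]; first exact: legendreM_eq1.
have lq : legendre q p = 1.
  have := sn _ qn; move: qn; rewrite mem_primes => /and3P[pq _ _] qy.
  have [_ _ /(_ q (prime_gt0 pq)) minq] := least_nonresidueP pp op.
  have : (least_nonresidue p <= p)%N.
    by rewrite -[X in (_ <= X)%N](size_iota 0 p) find_size.
  move: minq; rewrite /legendre; case: ifP => [/dvdn_leq|_].
    by rewrite prime_gt0 // => /(_ isT); lia.
  by case: ifP => // _ /(_ erefl); lia.
by elim: (logn q n) => // k IH; rewrite expnS; apply: legendreM_eq1.
Qed.

(** Second-moment comparison for [Z], with one factor [#|S|] cancelled. *)
Lemma psi_card_bound (N M y : nat) (S : {set 'I_N.+1}) :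
  (forall p, p \in S -> [/\ prime p, odd p & (y < least_nonresidue p)%N]) ->
  (psi M y * #|S| <= M.+1 + #|S| * N ^ 2)%N.
Proof.
move=> hS; have [->|K0] := posnP #|S|; first by rewrite muln0.
rewrite -(leq_pmul2l K0) -lez_nat; set K := #|S|.
pose Z n : int := \sum_(p in S) legendre n p.
apply: (@le_trans _ _ (\sum_(0 <= n < M.+1) Z n ^+ 2)).
  rewrite /psi big_distrl big_distrr /= (big_morph Posz PoszD (erefl _)).
  apply: ler_sum => n _; case sn: (smooth y n); last by rewrite muln0 sqr_ge0.
  rewrite mul1n /Z (eq_bigr (fun=> 1)) ?sumr_const => [|p /hS[pp op yp]].
    by rewrite -natrX; lia.
  exact: smooth_legendre sn.
under eq_bigr do rewrite expr2 /Z mulr_suml.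
rewrite exchange_big /=.
apply: (@le_trans _ _ (\sum_(p in S) (M.+1 + K * N ^ 2)%:Z)); last first.
  by rewrite sumr_const -/K; lia.
apply: ler_sum => p pS; have [pp op _] := hS p pS.
under eq_bigr do rewrite mulr_sumr.
(* The diagonal term [q = p] gives at most [M + 1], every other [q] at most [p q <= N ^ 2]. *)
rewrite exchange_big /= (bigD1 p) //= PoszD; apply: lerD.
  apply: (@le_trans _ _ (\sum_(0 <= n < M.+1) 1)); last first.
    by rewrite sumr_const_nat; lia.
  apply: ler_sum => n _; apply: le_trans (ler_norm _) _.
  by rewrite normrM mulr_ile1 ?normr_legendre_le1.
apply: (@le_trans _ _ (\sum_(q in S) (N ^ 2)%:Z)); last first.
  by rewrite sumr_const -/K; lia.
rewrite [leRHS](bigD1 p) //=; apply: ler_wpDl => //.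
apply: ler_sum => q /andP[qS nqp]; have [pq _ _] := hS q qS.
apply: le_trans (sum_legendreM_le _ pp op pq _) _; first by rewrite eq_sym.
by rewrite lez_nat -mulnn leq_mul // -ltnS.
Qed.

Lemma leq_psi (X y : nat) : (X <= y)%N -> (X <= psi X y)%N.
Proof.
move=> leXy; rewrite /psi big_ltn // add0n.
rewrite (eq_big_nat _ _ (F2 := fun=> 1%N)) => [|n /andP[n0 nX]].
  by rewrite sum_nat_const_nat; lia.
rewrite /smooth n0 (_ : all _ _) //; apply/allP => q.
by rewrite mem_primes => /and3P[_ _ /(dvdn_leq n0)]; lia.
Qed.

Lemma sum_dvdn_mul (F : nat -> nat) (p X : nat) : (0 < p)%N ->
  (\sum_(0 <= m < (X %/ p).+1) F (p * m)%N =
   \sum_(0 <= n < X.+1 | p %| n) F n)%N.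
Proof.
move=> p0; elim: X => [|X IH].
  by rewrite div0n big_nat1 big_mkcond big_nat1 dvdn0 muln0.
rewrite [RHS]big_mkcond big_nat_recr //= -big_mkcond -IH divnS //.
case: ifP => [pX|_]; last by rewrite addn0.
rewrite add1n big_nat_recr //=; congr (_ + F _)%N.
by have := divnK pX; rewrite divnS // pX mulnC add1n.
Qed.

Lemma expn_count_primes_le (w n : nat) : (0 < n)%N ->
  (w ^ count (ltn w) (primes n) <= n)%N.
Proof.
move=> n0; rewrite [leqRHS](prod_prime_decomp n0) prime_decompE big_map /=.
rewrite -iter_muln_1 -big_const_seq big_mkcond !big_seq.
apply: leq_prod => q; rewrite mem_primes => /and3P[pq _ qn].
have ln0 : (0 < logn q n)%N by rewrite logn_gt0 mem_primes pq n0.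
case: ifP => [wq|_]; last by rewrite expn_gt0 prime_gt0.
by apply: leq_trans (ltnW wq) _; rewrite -{1}[q]expn1 leq_pexp2l // prime_gt0.
Qed.

(** Multiplication by [p] sends smooth [m <= X / p] to smooth multiples of [p] up to [X]. Each [n]
    is then counted once per prime factor in [(w, y]], at most [E] times because [n <= w ^ E]. *)
Lemma sum_psi_div_le (E X w y : nat) : (1 < w)%N -> (X <= w ^ E)%N ->
  (\sum_(w.+1 <= p < y.+1 | prime p) psi (X %/ p) y <= E * psi X y)%N.
Proof.
move=> w1 XE.
apply: (@leq_trans (\sum_(w.+1 <= p < y.+1 | prime p)
    \sum_(0 <= n < X.+1) (p %| n) * smooth y n)).
  rewrite big_nat_cond [leqRHS]big_nat_cond.
  apply: leq_sum => p /andP[/andP[wp py] pp]; have p0 := prime_gt0 pp.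
  under [leqRHS]eq_bigr do rewrite mulnbl.
  rewrite -big_mkcond -sum_dvdn_mul // /psi; apply: leq_sum => m _.
  case sm: (smooth y m) => //; rewrite /smooth; case/andP: sm => m0 /allP sm.
  rewrite muln_gt0 p0 m0 (_ : all _ _) //; apply/allP => q.
  rewrite primesM // primes_prime // !inE => /orP[/eqP ->|/sm //].
  by rewrite -ltnS.
rewrite exchange_big /psi big_distrr /= big_nat_cond [leqRHS]big_nat_cond.
apply: leq_sum => n /andP[/andP[_ nX] _]; rewrite -big_distrl /=.
case sn: (smooth y n); last by rewrite !muln0.
have n0 : (0 < n)%N by case/andP: sn.
rewrite !muln1 -(leq_exp2l _ _ w1); apply: leq_trans XE.
apply: leq_trans (leq_trans (expn_count_primes_le w n0) _); last by rewrite -ltnS.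
rewrite leq_exp2l // -big_mkcondr /= sum1_count -!size_filter.
apply: uniq_leq_size => [|q]; first by rewrite filter_uniq ?iota_uniq.
rewrite !mem_filter mem_index_iota mem_primes n0.
by case/andP=> /andP[-> ->] /andP[wq _]; rewrite !andbT.
Qed.

(** * Sums over primes *)

Lemma prime_mul_logn_fact_le (p n : nat) : prime p ->
  (p.-1 * logn p n`! <= n)%N.
Proof.
move=> pp; have p0 := prime_gt0 pp; rewrite logn_fact //.
(* The extra term [n %/ p ^ m] bounds the tail of the geometric series in Legendre's formula and
   lets the induction close. *)
have th m : (p.-1 * (\sum_(1 <= k < m.+1) n %/ p ^ k) + n %/ p ^ m <= n)%N.
  elim: m => [|m IH]; first by rewrite big_geq // muln0 expn0 divn1.
  apply: leq_trans IH; rewrite big_nat_recr //= mulnDr -addnA leq_add2l.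
  rewrite -[X in (_ + X)%N]mul1n -mulnDl addn1 prednK // expnSr divnMA mulnC.
  exact: leq_divM.
by apply: leq_trans (th n); apply: leq_addr.
Qed.

Lemma leq_div_logn_fact (p n : nat) : prime p -> (n %/ p <= logn p n`!)%N.
Proof.
move=> pp; case: n => [|n]; first by rewrite div0n.
by rewrite logn_fact // big_ltn // expn1 leq_addr.
Qed.

Lemma fact_prod_primes (n : nat) :
  n`! = (\prod_(0 <= p < n.+1 | prime p) p ^ logn p n`!)%N.
Proof.
rewrite -{1}(partnT (fact_gt0 n)) /partn.
(* The product up to [n!] is cut at [n]: larger primes do not divide [n!]. *)
rewrite (@big_cat_nat _ _ _ n.+1) //= ?ltnS ?fact_geq //.
rewrite [X in (_ * X)%N]big1_seq ?muln1 => [|p /andP[_]].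
  rewrite [RHS]big_mkcond /= big_mkcond /=; apply: eq_bigr => p _.
  by case: ifP => // np; rewrite lognE np.
rewrite mem_index_iota => /andP[np _].
have [pp|npp] := boolP (prime p); last by rewrite lognE (negPf npp).
rewrite logn_fact // big_nat_cond big1 ?expn0 // => k /andP[/andP[k0 _] _].
rewrite divn_small //; apply: leq_trans np _.
by rewrite -{1}[p]expn1 leq_pexp2l // prime_gt0.
Qed.

Lemma ln_fact_primes (R : realType) (n : nat) :
  ln n`!%:R = \sum_(0 <= p < n.+1 | prime p) (logn p n`!)%:R * ln p%:R :> R.
Proof.
have th (s : seq nat) : [/\ (0 < \prod_(p <- s | prime p) p ^ logn p n`!)%N &
    ln (\prod_(p <- s | prime p) p ^ logn p n`!)%N%:R =
    \sum_(p <- s | prime p) (logn p n`!)%:R * ln p%:R :> R].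
  elim: s => [|p s [IH0 IH]]; first by rewrite !big_nil ln1.
  rewrite !big_cons; case: ifP => // pp; have p0 := prime_gt0 pp.
  split; first by rewrite muln_gt0 expn_gt0 p0.
  rewrite natrM lnM ?posrE ?ltr0n ?expn_gt0 ?p0 // IH natrX.
  by rewrite lnXn ?ltr0n // mulr_natl.
by rewrite {1}fact_prod_primes; case: (th (index_iota 0 n.+1)).
Qed.

Lemma ln_fact_le (R : realType) (n : nat) : ln n`!%:R <= n%:R * ln n%:R :> R.
Proof.
have [->|n0] := posnP n; first by rewrite ln1 mul0r.
rewrite mulr_natl -lnXn ?ltr0n // -natrX.
rewrite ler_ln ?posrE ?ltr0n ?fact_gt0 ?expn_gt0 ?n0 // ler_nat.
rewrite fact_prod.
have -> : (n ^ n = \prod_(1 <= i < n.+1) n)%N by rewrite prod_nat_const_nat subn1.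
rewrite big_nat_cond [leqRHS]big_nat_cond; apply: leq_prod => i.
by rewrite ltnS => /andP[/andP[]].
Qed.

(** The induction step amounts to [n (ln (n + 1) - ln n) <= 1]. *)
Lemma ln_fact_ge (R : realType) (n : nat) :
  n%:R * ln n%:R - n%:R <= ln n`!%:R :> R.
Proof.
elim: n => [|n IH]; first by rewrite mul0r subr0 ln1.
have [->|n0] := posnP n; first by rewrite ln1 mulr0 subr_le0 ler01.
have n0R : 0 < n%:R :> R by rewrite ltr0n.
rewrite factS natrM lnM ?posrE ?ltr0n ?fact_gt0 //.
have : ln (1 + n%:R^-1) <= n%:R^-1 :> R.
  by apply: le_ln1Dx; apply: (@lt_trans _ _ 0); rewrite ?ltrN10 ?invr_gt0.
have -> : 1 + n%:R^-1 = n.+1%:R / n%:R :> R.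
  by rewrite -natr1 mulrDl divff ?gt_eqF // mul1r.
rewrite ln_div ?posrE ?ltr0n // -(ler_pM2l n0R) divff ?gt_eqF //.
rewrite -(natr1 n) in IH *; lra.
Qed.

Lemma sum_ln_div_prime_le (R : realType) (n : nat) : (0 < n)%N ->
  \sum_(0 <= p < n.+1 | prime p) ln p%:R / p%:R <= 2 * ln n%:R :> R.
Proof.
move=> n0; have n0R : 0 < n%:R :> R by rewrite ltr0n.
have := ln_fact_le R n; rewrite ln_fact_primes.
suff : n%:R / 2 * (\sum_(0 <= p < n.+1 | prime p) ln p%:R / p%:R) <=
       \sum_(0 <= p < n.+1 | prime p) (logn p n`!)%:R * ln p%:R :> R.
  move=> /le_trans le1 /le1; rewrite -mulrA ler_pM2l //; lra.
rewrite mulr_sumr big_nat_cond [leRHS]big_nat_cond.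
apply: ler_sum => p /andP[/andP[_ pn] pp].
have p0 := prime_gt0 pp; have p0R : 0 < p%:R :> R by rewrite ltr0n.
have lnp : 0 <= ln p%:R :> R by rewrite ln_ge0 // ler1n.
rewrite mulrCA mulrC ler_wpM2r // ler_pdivrMr // ler_pdivrMr ?ltr0n //.
rewrite -!natrM ler_nat; have := leq_div_logn_fact n pp.
(* As the quotient is at least 1, rounding down loses at most a factor 2. *)
have : (0 < n %/ p)%N by rewrite divn_gt0.
by have := ltn_ceil n p0; nia.
Qed.

Lemma sum_ln_div_prime_ge (R : realType) (n : nat) : (0 < n)%N ->
  (ln n%:R - 1) / 2 <= \sum_(0 <= p < n.+1 | prime p) ln p%:R / p%:R :> R.
Proof.
move=> n0; have n0R : 0 < n%:R :> R by rewrite ltr0n.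
have := ln_fact_ge R n; rewrite ln_fact_primes.
suff : \sum_(0 <= p < n.+1 | prime p) (logn p n`!)%:R * ln p%:R <=
   n%:R * 2 * (\sum_(0 <= p < n.+1 | prime p) ln p%:R / p%:R) :> R.
  move=> le2 /le_trans /(_ le2).
  rewrite -{3}[n%:R]mulr1 -mulrBr -mulrA ler_pM2l //; lra.
rewrite mulr_sumr; apply: ler_sum => p pp.
have p0 := prime_gt0 pp; have p0R : 0 < p%:R :> R by rewrite ltr0n.
have lnp : 0 <= ln p%:R :> R by rewrite ln_ge0 // ler1n.
rewrite mulrCA mulrC ler_wpM2l // ler_pdivlMr // -!natrM ler_nat.
by have := prime_mul_logn_fact_le n pp; have := prime_gt1 pp; nia.
Qed.

Lemma sum_inv_prime_ge (R : realType) (w : nat) : 1 <= ln w%:R :> R ->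
  1 / 12 <= \sum_(w.+1 <= p < (w ^ 6).+1 | prime p) p%:R^-1 :> R.
Proof.
move=> lnw; have w0 : (0 < w)%N.
  by rewrite lt0n; apply/eqP => w0; move: lnw; rewrite w0 ln0 // ler10.
have w6 : (0 < w ^ 6)%N by rewrite expn_gt0 w0.
have := sum_ln_div_prime_ge R w6; have := sum_ln_div_prime_le R w0.
rewrite natrX lnXn ?ltr0n // (@big_cat_nat _ _ _ w.+1 0 (w ^ 6).+1) //=; last first.
  by rewrite ltnS -{1}[w]expn1 leq_pexp2l.
set L := ln w%:R in lnw *; set s1 := \sum_(0 <= _ < _ | _) _.
set s2 := \sum_(w.+1 <= _ < _ | _) _; set s3 := \sum_(_ <= _ < _ | _) _.
have : s2 <= 6 * L * s3.
  rewrite /s2 /s3 mulr_sumr big_nat_cond [leRHS]big_nat_cond.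
  apply: ler_sum => p /andP[/andP[_ pw] pp]; have p0 := prime_gt0 pp.
  rewrite ler_wpM2r ?invr_ge0 ?ler0n // /L mulr_natl -lnXn ?ltr0n // -natrX.
  by rewrite ler_ln ?posrE ?ltr0n // ler_nat.
(* From [s1 <= 2 L] and [(6 L - 1) / 2 <= s1 + s2] follows [s2 >= L - 1/2 >= L / 2], as [L >= 1];
   dividing by [6 L] gives 1/12. *)
nra.
Qed.

(** * Density of smooth numbers *)

(** Each induction step costs [24 (6 + J)]: 12 from the sum of [1 / p], 2 from rounding [X / p], and
    [6 + J] from the number of prime factors above [w]. *)
Lemma psi_ge (R : realType) (J w j X : nat) : 1 <= ln w%:R :> R -> (j <= J)%N ->
  (X <= w ^ (6 + j))%N -> (X <= (24 * (6 + J)) ^ j * psi X (w ^ 6))%N.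
Proof.
move=> lnw; have w1 : (1 < w)%N.
  rewrite ltnNge; apply/negP => w1.
  have lnw0 : ln w%:R <= 0 :> R by rewrite ln_le0 // lern1.
  by have := le_trans lnw lnw0; rewrite ler10.
elim: j X => [|j IH] X jJ; first by rewrite addn0 expn0 mul1n; apply: leq_psi.
have [Xw _|wX XE] := leqP X (w ^ 6).
  by apply: leq_trans (leq_psi Xw) _; rewrite leq_pmull // expn_gt0.
have XEJ : (X <= w ^ (6 + J))%N.
  by apply: leq_trans XE _; rewrite leq_pexp2l ?leq_add2l // ltnW.
have := sum_psi_div_le (w ^ 6) w1 XEJ.
set D := (24 * (6 + J))%N; set S := (\sum_(_ <= _ < _ | _) _)%N => leS.
suff : (X <= D ^ j * (24 * S))%N.
  by move/leq_trans; apply; rewrite expnSr -mulnA leq_mul // /D -mulnA leq_mul.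
rewrite -(ler_nat R) !natrM /S natr_sum mulr_sumr mulr_sumr.
apply: (@le_trans _ _ (12 * X%:R *
    \sum_(w.+1 <= p < (w ^ 6).+1 | prime p) p%:R^-1)).
  by have := sum_inv_prime_ge lnw; have : 0 <= X%:R :> R := ler0n _ _; nra.
rewrite mulr_sumr big_nat_cond [leRHS]big_nat_cond.
apply: ler_sum => p /andP[/andP[wp pw] pp]; have p0 := prime_gt0 pp.
have Xp0 : (0 < X %/ p)%N by rewrite divn_gt0 //; lia.
(* Because [p > w], the quotient is at most [w ^ (6 + j)]. *)
have : (X %/ p <= D ^ j * psi (X %/ p) (w ^ 6))%N.
  apply: IH; first exact: ltnW.
  apply: leq_trans (leq_div2l X _ (ltnW wp)) _; first exact: ltnW.
  by apply: leq_trans (leq_div2r w XE) _; rewrite addnS expnSr mulnK // ltnW.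
have := ltn_ceil X p0.
rewrite ler_pdivrMr ?ltr0n // -!natrM ler_nat; nia.
Qed.

(** * Choice of parameters and the uniform bound *)

Unset Implicit Arguments.

Theorem corollary5 (R : realType) (eps : R) (heps : 0 < eps) :
  exists C : nat, forall N : nat, (0 < N)%N ->
    (#|[set p : 'I_N.+1 | [&& prime p, odd p &
          (N%:R `^ eps < (least_nonresidue p)%:R :> R)%R]]%SET| <= C)%N.
Proof.
(* [J > 18 / eps] ensures [E * eps / 6 >= 3], hence [z ^ E >= N ^ 3]; [w0 > e] ensures [ln w >= 1]
   once [w >= w0]. *)
pose J := (Num.truncn (18 / eps)).+1; pose E := (6 + J)%N.
pose B := ((24 * E) ^ J)%N; pose w0 := (Num.truncn (expR 1 : R)).+1.
(* [4 * B] is the bound for large [N]; the other summands absorb [#|S| <= N + 1] when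
   [N < 2 ^ E.+1 * B] or [w < w0]. *)
exists (4 * B + 2 ^ E.+1 * B + w0 ^ E + 1)%N => N N0.
set S := [set p | _]%SET; have leSN : (#|S| <= N.+1)%N.
  by rewrite -[X in (_ <= X)%N]card_ord max_card.
have NR : 1 <= N%:R :> R by rewrite ler1n.
pose z : R := N%:R `^ (eps / 6); have z0 : 0 <= z := powR_ge0 _ _.
pose w := Num.truncn z; have [wz zw] : w%:R <= z /\ z < w.+1%:R.
  by apply/andP; exact: truncn_itv.
have hS p : p \in S -> [/\ prime p, odd p & (w ^ 6 < least_nonresidue p)%N].
  rewrite inE => /and3P[pp op lp]; split=> //; rewrite -(ltr_nat R).
  apply: le_lt_trans lp; rewrite natrX.
  have -> : N%:R `^ eps = z ^+ 6 :> R.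
    by rewrite -powR_mulrn // -powRrM divfK // pnatr_eq0.
  by rewrite lerXn2r ?nnegrE.
have N3 : (N ^ 3 <= w.+1 ^ E)%N.
  rewrite -(ler_nat R) !natrX; apply: (@le_trans _ _ (z ^+ E)); last first.
    by rewrite lerXn2r ?nnegrE // ltW.
  rewrite -powR_mulrn // -powRrM -powR_mulrn ?ler0n //; apply: ler_powR => //.
  have : 18 / eps < J%:R := truncnS_gt _.
  rewrite ltr_pdivrMr // /E natrD; nra.
have [w0w|ww0] := leqP w0 w; last first.
  have : (N <= N ^ 3)%N by rewrite -{1}[N]expn1 leq_pexp2l.
  have : (w.+1 ^ E <= w0 ^ E)%N by rewrite leq_exp2r.
  lia.
have lnw : 1 <= ln w%:R :> R.
  have w_gt0 : 0 < w%:R :> R by rewrite ltr0n; apply: leq_trans w0w.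
  rewrite -ler_expR lnK ?posrE //; apply: ltW; apply: lt_le_trans (truncnS_gt _) _.
  by rewrite ler_nat.
have w_gt0 : (0 < w)%N by apply: leq_trans w0w.
have psiB : (w ^ E <= B * psi (w ^ E) (w ^ 6))%N := psi_ge lnw (leqnn J) (leqnn _).
have := psi_card_bound (w ^ E) hS.
have leM : (w.+1 ^ E <= 2 ^ E * w ^ E)%N.
  by rewrite -expnMn leq_exp2r //; lia.
have M0 : (0 < w ^ E)%N by rewrite expn_gt0 w_gt0.
have E0 : (0 < 2 ^ E)%N by rewrite expn_gt0.
have [NB|] := leqP (2 ^ E.+1 * B) N; last by lia.
move: (w ^ E)%N (w.+1 ^ E)%N (2 ^ E)%N (expnS 2 E) N3 psiB leM M0 E0 NB.
move=> M M1 T -> N3; move: (psi _ _) #|S| => Ps K psiB leM M0 T0 NB bnd.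
(* Combines [N >= 2 T B] with [N ^ 3 <= M1 <= T M] and cancels [T]. *)
have leBN : (2 * B * N ^ 2 <= M)%N.
  rewrite -(leq_pmul2l T0); apply: leq_trans leM; apply: leq_trans N3.
  by rewrite [(N ^ 3)%N]expnS mulnA leq_mul //; lia.
have : (M * K <= B * (M.+1 + K * N ^ 2))%N.
  apply: leq_trans (_ : B * (Ps * K) <= _)%N; first by rewrite mulnA leq_mul2r psiB orbT.
  by rewrite leq_mul2l bnd orbT.
(* Doubling the last bound, [2 B K N ^ 2 <= M K] absorbs the off-diagonal part and [M + 1 <= 2 M]
   the rest. *)
suff : (2 * (M * K) <= 4 * B * M + M * K -> K <= 4 * B)%N.
  nia.
by rewrite mul2n -addnn leq_add2r mulnC leq_pmul2r // => ?; lia.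
Qed.
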